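(* Let $R$ be a polynomial ring over a field, let $I\subseteq R$ be the edge ideal of a graph, and let $P\in\operatorname{Min}(R/I)$. Suppose that $a,b$ is a leaf pair in $I$ and let $I_1=\operatorname{in}_{>}(I,a+b)$ with respect to a term order $>$ such that $a>b$. If $a\notin P$, then $(P,a)\in\operatorname{Min}(R/I_1)$, and if $a\in P$, then $(P,b)\in\operatorname{Min}(R/I_1)$.
   Context: The edge ideal of a graph whose vertices are identified with the variables of $R$ is the ideal generated by the monomials $xy$ with $\{x,y\}$ an edge. For a monomial ideal $I$, $\mathcal{G}(I)$ is its set of (minimal) monomial generators. A variable $a$ is a leaf for $I$ if there is a unique $M\in\mathcal{G}(I)$ with $a\mid M$. Two leaves $x,y$ in $I$ form a leaf pair if, with $M_1\ne M_2$ the unique monomial generators of $I$ such that $x\mid M_1$ and $y\mid M_2$, there exist monomials $z,w\in R$ with $\gcd(z,w)=1$ such that $x\nmid z$, $z\mid M_1$, $y\nmid w$, $w\mid M_2$, and $zw\in I$. (For an edge ideal of a graph, a leaf pair is a pair of leaves at distance $3$.) $\operatorname{Min}(R/J)$ is the set of minimal associated primes of $R/J$. $\operatorname{in}_{>}(I,f)$ is the initial ideal with respect to $>$ of the ideal generated by $I$ and $f$; $(P,a)$ is the ideal generated by $P$ and $a$. *)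

(* Defs.v *)
From mathcomp Require Import all_boot all_order all_algebra.
From mathcomp Require Import ring_quotient mpoly boolp.

Set Implicit Arguments.
Unset Strict Implicit.
Unset Printing Implicit Defensive.

Import GRing.Theory.
Local Open Scope ring_scope.

Section Ideals.
Variable R : comNzRingType.
Implicit Types (S : R -> Prop) (J P : {pred R}).

Definition ideal_gen S : {pred R} :=
  [pred f | `[< exists2 s : seq (R * R),
                  (forall c, c \in s -> S c.2)
                & f = \sum_(c <- s) c.1 * c.2 >]].

(* The ideal (J, f). *)
Definition ideal_adj J (f : R) : {pred R} :=
  ideal_gen (fun g => g \in J \/ g = f).

(* [idealr_closed] includes 1 \notin P. *)
Definition prime_ideal P : Prop := idealr_closed P /\ prime_idealr_closed P.

(* P \in Ass(R/J): P is a prime ideal and the annihilator of the class of some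
   f in the R-module R/J, i.e. P = (J : f). *)
Definition assoc_prime J P : Prop :=
  prime_ideal P /\ exists f : R, forall g : R, (g \in P) = (g * f \in J).

(* P \in Min(R/J). *)
Definition min_assoc_prime J P : Prop :=
  assoc_prime J P /\
  forall Q : {pred R}, assoc_prime J Q -> {subset Q <= P} -> {subset P <= Q}.

End Ideals.

Section Monomials.
Variable n : nat.
Implicit Types (m z w : 'X_{1..n}) (le : rel 'X_{1..n}).

Definition mgcd z w : 'X_{1..n} := [multinom minn (z i) (w i) | i < n].

Definition term_order le : Prop :=
  [/\ total le, antisymmetric le, transitive le,
      forall m, le 0%MM m
    & forall m1 m2 m, le m1 m2 -> le (m1 + m)%MM (m2 + m)%MM].

(* m1 > m2 *)
Definition term_gt le m1 m2 : bool := (m1 != m2) && le m2 m1.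

End Monomials.

Section PolynomialRing.
Variables (k : fieldType) (n : nat).
Implicit Types (I J : {pred {mpoly k[n]}}) (le : rel 'X_{1..n}).

Definition edge_ideal (e : rel 'I_n) : {pred {mpoly k[n]}} :=
  ideal_gen (fun f => exists i j : 'I_n, e i j /\ f = 'X_i * 'X_j).

(* m \in G(I): the minimal monomial generators of a monomial ideal I are the
   monomials of I that are minimal for divisibility. Monomials are encoded by
   their exponent vectors, on which divisibility is (_ <= _)%MM. *)
Definition min_gen I (m : 'X_{1..n}) : Prop :=
  'X_[m] \in I /\
  forall m' : 'X_{1..n}, 'X_[m'] \in I -> (m' <= m)%MM -> m' = m.

Definition leaf I (a : 'I_n) : Prop :=
  exists! M : 'X_{1..n}, min_gen I M /\ (U_(a) <= M)%MM.

Definition leaf_pair I (x y : 'I_n) : Prop :=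
  leaf I x /\ leaf I y /\
  exists M1 M2 : 'X_{1..n},
    [/\ min_gen I M1 /\ (U_(x) <= M1)%MM,
        min_gen I M2 /\ (U_(y) <= M2)%MM,
        M1 <> M2
      & exists z w : 'X_{1..n},
          [/\ mgcd z w = 0%MM,
              ~~ (U_(x) <= z)%MM /\ (z <= M1)%MM,
              ~~ (U_(y) <= w)%MM /\ (w <= M2)%MM
            & 'X_[(z + w)%MM] \in I]].

(* m is the leading monomial of the (necessarily nonzero) polynomial f. *)
Definition lead_mon le (f : {mpoly k[n]}) (m : 'X_{1..n}) : Prop :=
  m \in msupp f /\ forall m' : 'X_{1..n}, m' \in msupp f -> le m' m.

Definition initial_ideal le J : {pred {mpoly k[n]}} :=
  ideal_gen (fun g => exists f : {mpoly k[n]}, exists m : 'X_{1..n},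
                [/\ f \in J, lead_mon le f m & g = 'X_[m]]).

End PolynomialRing.

Arguments edge_ideal k {n} e _.

(* Main.v *)
Require Import Defs.
From mathcomp Require Import all_boot all_order all_algebra.
From mathcomp Require Import mpoly.
From mathcomp Require Import boolp.

Set Implicit Arguments.
Unset Strict Implicit.
Unset Printing Implicit Defensive.

Import GRing.Theory.
Local Open Scope ring_scope.

(** For a set [D] of variables let [(D)] be the prime ideal it generates.  The
    whole proof turns on one criterion ([min_assoc_var_ideal]): if [J] is an
    ideal contained in [(D)] and every variable of [D] either lies in [J] or
    has a multiple by a variable outside [D] lying in [J], then [(D)] is a
    minimal associated prime of [J].

    The criterion first identifies the minimal primes of an edge ideal: they
    are the ideals [(C)] with [C] a minimal vertex cover
    ([min_prime_edge_ideal]), since in a minimal cover each vertex [v] has a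
    neighbour outside the cover ([minset_cover_private]).  So [P = (C)], and
    [(P, a)] and [(P, b)] are [(C + a)] and [(C + b)].

    The leaf pair is a path [a - x - y - b] in which [x] is the only neighbour
    of [a] and [y] the only neighbour of [b] ([leaf_pair_path]).  The ideal
    [I1] contains [a], the monomials of all edges, and also [x * b], because
    [x * b = x * (a + b) - a * x].  Thus, away from [a], it looks like the edge
    ideal of the graph in which [b] takes over the edge of [a].  It then
    suffices to give every vertex of the candidate set a partner outside the
    set, along these monomials.
    - If [a] is not in [C], the set is [C + a].  A neighbour outside [C] still
      serves, unless it is [a] itself.  This happens only for [x], whose new
      partner is [b] if [b] is outside [C], and otherwise [y], which is outside
      [C] because it is the only possible partner of [b].
    - If [a] is in [C], the set is [C + b] and [x] is outside [C].  A neighbour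
      outside [C] still serves, unless it is [b].  This happens only for [y],
      and both [y] and [b] can take the partner [x].

    That [I1] is contained in the candidate prime is proved by substitution: a
    substitution [h] that sends each variable to something no larger in the
    term order cannot cancel the leading monomial of [f] if it fixes that
    monomial.  When [h] moves only variables of [D] and kills an ideal, every
    leading monomial of that ideal must therefore meet [D]
    ([initial_ideal_sub_var_ideal]).  For [C + a] the substitution sends [a] to
    [- b] (or to [0] when [b] is in [C]) and the variables of [C] to [0]; for
    [C + b], which contains both [a] and [b], it sends the whole set to [0]. *)

(** * Generated ideals *)

Section IdealGen.
Variable R : comNzRingType.
Implicit Types (S : R -> Prop) (J Q : {pred R}).

(** Properness is left out, so that every [ideal_gen] qualifies. *)
Definition is_ideal J : Prop :=
  0 \in J /\ forall c u v, u \in J -> v \in J -> c * u + v \in J.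

Lemma is_idealM J c u : is_ideal J -> u \in J -> c * u \in J.
Proof. by case=> J0 Jlin uJ; rewrite -[_ * _]addr0; apply: Jlin. Qed.

Lemma is_idealD J u v : is_ideal J -> u \in J -> v \in J -> u + v \in J.
Proof. by case=> _ Jlin uJ vJ; rewrite -[u]mul1r; apply: Jlin. Qed.

Lemma is_ideal_sum J (I : eqType) (r : seq I) (F : I -> R) :
  is_ideal J -> {in r, forall i, F i \in J} -> \sum_(i <- r) F i \in J.
Proof.
move=> JI FJ; rewrite big_seq; elim/big_ind: _ => [|u v|i ir]; last exact: FJ.
  by case: JI.
exact: is_idealD.
Qed.

Lemma prime_ideal_is_ideal Q : prime_ideal Q -> is_ideal Q.
Proof. by case=> -[Q0 _ Qlin] _; split=> // c u v uQ vQ; apply: Qlin. Qed.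

Lemma ideal_gen_is_ideal S : is_ideal (ideal_gen S).
Proof.
split=> [|c u v].
  by rewrite inE; apply/asboolP; exists [::]; rewrite ?big_nil.
rewrite !inE => /asboolP[s sS ->] /asboolP[t tS ->]; apply/asboolP.
exists ([seq (c * x.1, x.2) | x <- s] ++ t) => [y|].
  by rewrite mem_cat => /orP[/mapP[x xs ->] /=|]; [apply: sS | apply: tS].
rewrite big_cat big_map mulr_sumr /=; congr (_ + _).
by apply: eq_bigr => x _; rewrite mulrA.
Qed.

Lemma mem_ideal_gen S g : S g -> g \in ideal_gen S.
Proof.
move=> Sg; rewrite inE; apply/asboolP; exists [:: (1, g)].
  by move=> c; rewrite inE => /eqP->.
by rewrite big_seq1 mul1r.
Qed.

Lemma ideal_gen_sub S J :
  is_ideal J -> (forall g, S g -> g \in J) -> {subset ideal_gen S <= J}.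
Proof.
move=> JI SJ f; rewrite inE => /asboolP[s sS ->].
by apply: is_ideal_sum => // c cs; apply: is_idealM => //; apply/SJ/sS.
Qed.

Lemma ideal_adj_is_ideal J f : is_ideal (ideal_adj J f).
Proof. exact: ideal_gen_is_ideal. Qed.

Lemma mem_ideal_adjl J f g : g \in J -> g \in ideal_adj J f.
Proof. by move=> gJ; apply: mem_ideal_gen; left. Qed.

Lemma mem_ideal_adjr J f : f \in ideal_adj J f.
Proof. by apply: mem_ideal_gen; right. Qed.

Lemma ideal_adj_sub J f Q :
  is_ideal Q -> {subset J <= Q} -> f \in Q -> {subset ideal_adj J f <= Q}.
Proof. by move=> QI JQ fQ; apply: ideal_gen_sub => // g [/JQ|->]. Qed.

Lemma assoc_prime_sub J Q : is_ideal J -> assoc_prime J Q -> {subset J <= Q}.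
Proof. by move=> JI [_ [f Qf]] g gJ; rewrite Qf mulrC is_idealM. Qed.

End IdealGen.

(** * Substitutions and ideals generated by variables *)

Section Substitution.
Variables (k : fieldType) (n : nat).
Implicit Types (h : 'I_n -> {mpoly k[n]}) (f g : {mpoly k[n]}).
Implicit Types (J Q : {pred {mpoly k[n]}}) (D : {set 'I_n}).

Local Notation "f .[: h ]" := (f \mPo [tuple h i | i < n])
  (at level 2, left associativity, format "f .[: h ]").

Lemma monom_neq0 (m : 'X_{1..n}) : 'X_[m] != 0 :> {mpoly k[n]}.
Proof. by rewrite -msupp_eq0 msuppX. Qed.

Lemma subst_var h i : ('X_i).[: h] = h i.
Proof. by rewrite comp_mpolyXU -tnth_nth tnth_mktuple. Qed.

Lemma subst_monom h (m : 'X_{1..n}) : 'X_[m].[: h] = \prod_i h i ^+ m i.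
Proof.
by rewrite comp_mpolyX; apply: eq_bigr => i _; rewrite tnth_mktuple.
Qed.

Lemma subst_monom_id h (m : 'X_{1..n}) :
  (forall i, (0 < m i)%N -> h i = 'X_i) -> 'X_[m].[: h] = 'X_[m].
Proof.
move=> hX; rewrite subst_monom mpolyXE_id; apply: eq_bigr => i _.
by case: (posnP (m i)) => [-> // | /hX->].
Qed.

Lemma ker_subst_is_ideal h : is_ideal [pred f | f.[: h] == 0].
Proof.
split=> [|c u v]; first by rewrite inE raddf0.
by rewrite !inE rmorphD rmorphM /= => /eqP-> /eqP->; rewrite mulr0 addr0.
Qed.

(** Congruence modulo [J] is compatible with sums and products, hence with the
    evaluation of a polynomial at two congruent families of points. *)
Lemma subst_congr J h f :
  is_ideal J -> (forall i, 'X_i - h i \in J) -> f - f.[: h] \in J.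
Proof.
move=> JI hJ.
have congM u u' v v' : u - u' \in J -> v - v' \in J -> u * v - u' * v' \in J.
  move=> uJ vJ; have -> : u * v - u' * v' = v * (u - u') + u' * (v - v').
    by rewrite !mulrBr addrA [v * u]mulrC [v * u']mulrC subrK.
  by apply: is_idealD => //; apply: is_idealM.
have cong1 : 1 - 1 \in J by rewrite subrr; case: JI.
rewrite {1}[f]mpolyE comp_mpolyEX -sumrB; apply: is_ideal_sum => // m _.
rewrite -scalerBr -mul_mpolyC; apply: is_idealM => //.
rewrite subst_monom mpolyXE_id.
elim/big_ind2: _ => // i _.
by elim: (m i) => [|d IHd]; rewrite ?expr0 // !exprS; apply: congM.
Qed.

Definition kill_vars D (i : 'I_n) : {mpoly k[n]} := if i \in D then 0 else 'X_i.

(** The ideal generated by the variables of [D], encoded as the kernel of the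
    substitution that kills them: being the kernel of a morphism to a domain, it
    is visibly prime. *)
Definition var_ideal D : {pred {mpoly k[n]}} :=
  [pred f | f.[: kill_vars D] == 0].

Lemma var_ideal_is_ideal D : is_ideal (var_ideal D).
Proof. exact: ker_subst_is_ideal. Qed.

Lemma var_ideal_prime D : prime_ideal (var_ideal D).
Proof.
have [D0 Dlin] := var_ideal_is_ideal D; split.
  by split=> [||c u v]; [ | rewrite inE rmorph1 oner_eq0 | apply: Dlin].
by move=> u v; rewrite !inE rmorphM mulf_eq0.
Qed.

Lemma var_ideal_monom D (m : 'X_{1..n}) :
  ('X_[m] \in var_ideal D) = [exists i in D, 0 < m i]%N.
Proof.
rewrite inE; apply/idP/exists_inP => [mD|[i iD mi_gt0]].
  apply/exists_inP; apply: contraTT mD => /exists_inPn mD0.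
  rewrite subst_monom_id ?monom_neq0 // => i mi_gt0; rewrite /kill_vars.
  by case: ifP => // /mD0; rewrite mi_gt0.
by rewrite subst_monom (bigD1 i) //= /kill_vars iD expr0n gtn_eqF // mul0r.
Qed.

Lemma var_ideal_var D i : ('X_i \in var_ideal D) = (i \in D).
Proof.
rewrite var_ideal_monom; apply/exists_inP/idP => [[j jD]|iD].
  by rewrite mnm1E; case: eqP => [->|].
by exists i; rewrite // mnm1E eqxx.
Qed.

(** With [var_ideal_var], this says that the kernel is the ideal generated by
    the variables of [D]: a polynomial is congruent, modulo these variables, to
    what remains of it when they are killed. *)
Lemma var_ideal_min D Q :
  is_ideal Q -> {in D, forall i, 'X_i \in Q} -> {subset var_ideal D <= Q}.
Proof.
move=> QI DQ f; rewrite inE => /eqP f0; rewrite -[f]subr0 -f0.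
apply: subst_congr => // i; rewrite /kill_vars.
by case: ifP => [/DQ|_]; rewrite ?subr0 // subrr; case: QI.
Qed.

Lemma var_ideal_adj D i : ideal_adj (var_ideal D) 'X_i = var_ideal (i |: D).
Proof.
have DI := var_ideal_is_ideal; apply: funext => f.
change ((f \in ideal_adj (var_ideal D) 'X_i) = (f \in var_ideal (i |: D))).
apply/idP/idP; move: f.
  apply: ideal_adj_sub; rewrite ?var_ideal_var ?setU11 //.
  by apply: (var_ideal_min (DI _)) => j jD; rewrite var_ideal_var setU1r.
apply: var_ideal_min => [|j]; first exact: ideal_adj_is_ideal.
case/setU1P=> [->|jD]; first exact: mem_ideal_adjr.
by apply: mem_ideal_adjl; rewrite var_ideal_var.
Qed.

Lemma prod_var_notin D : \prod_(u | u \notin D) 'X_u \notin var_ideal D.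
Proof.
rewrite inE rmorph_prod /=; apply/prodf_neq0 => u uD.
by rewrite subst_var /kill_vars (negbTE uD) monom_neq0.
Qed.

(** The product [p] of the variables outside [D] is multiplied into [J] by each
    variable of [D], so the prime [var_ideal D] is the annihilator of [p]
    modulo [J].  A smaller prime [Q] over [J] contains each ['X_v * p] but not
    [p], hence contains each ['X_v]. *)
Lemma min_assoc_var_ideal J D :
    is_ideal J -> {subset J <= var_ideal D} ->
    {in D, forall v, 'X_v \in J \/ exists2 u, u \notin D & 'X_v * 'X_u \in J} ->
  min_assoc_prime J (var_ideal D).
Proof.
move=> JI J_D partner; set p := \prod_(u | u \notin D) 'X_u : {mpoly k[n]}.
have pD : p \notin var_ideal D := prod_var_notin D.
have DJ : {in D, forall v, 'X_v * p \in J}.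
  move=> v /partner[vJ|[u uD uvJ]]; first by rewrite mulrC; apply: is_idealM.
  by rewrite /p (bigD1 u) //= mulrA mulrC; apply: is_idealM.
have Dprime := var_ideal_prime D; split.
  split=> //; exists p => g; apply/idP/idP => [gD|/J_D].
    suff DJp : {subset var_ideal D <= [pred g | g * p \in J]} by apply: DJp gD.
    apply: var_ideal_min => //; split=> [|c u v].
      by rewrite inE mul0r; case: JI.
    by rewrite !inE mulrDl -mulrA; case: JI => _; apply.
  by case: Dprime => _ /[apply]; rewrite (negbTE pD) orbF.
move=> Q QJ QD; have QI := prime_ideal_is_ideal QJ.1.
apply: var_ideal_min => // v /DJ /(assoc_prime_sub JI QJ).
by case: QJ.1 => _ /[apply] /orP[] // /QD; rewrite (negbTE pD).
Qed.

(** * Initial ideals *)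

Section InitialIdeal.
Variable le : rel 'X_{1..n}.
Hypothesis le_term : term_order le.

Lemma term_order_refl m : le m m.
Proof. by case: le_term => le_tot *; rewrite -[le m m]orbb. Qed.

Lemma term_orderD m1 m2 p1 p2 :
  le m1 p1 -> le m2 p2 -> le (m1 + m2)%MM (p1 + p2)%MM.
Proof.
case: le_term => _ _ le_trans _ leD le1 le2.
by apply: le_trans (leD _ _ _ le1) _; rewrite ![(p1 + _)%MM]addmC leD.
Qed.

Definition bounded f p := {in msupp f, forall m, le m p}.

Lemma bounded0 p : bounded 0 p.
Proof. by move=> m; rewrite msupp0. Qed.

Lemma bounded_var i : bounded 'X_i U_(i)%MM.
Proof. by move=> m; rewrite msuppX inE => /eqP->; apply: term_order_refl. Qed.

Lemma bounded1 : bounded 1 0%MM.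
Proof. by move=> m; rewrite msupp1 inE => /eqP->; apply: term_order_refl. Qed.

Lemma boundedM f g p q :
  bounded f p -> bounded g q -> bounded (f * g) (p + q)%MM.
Proof.
move=> fp gq m /msuppM_le/allpairsP[[m1 m2] /= [m1f m2g ->]].
by apply: term_orderD; [apply: fp | apply: gq].
Qed.

Lemma bounded_subst h (m : 'X_{1..n}) :
  (forall i, bounded (h i) U_(i)%MM) -> bounded 'X_[m].[: h] m.
Proof.
move=> hU; rewrite subst_monom {2}[m]multinomUE_id.
elim/big_ind2: _ => [|f p g q|i _]; [exact: bounded1 | exact: boundedM |].
elim: (m i) => [|d IHd]; first by rewrite mulm0n; apply: bounded1.
by rewrite exprS mulmS; apply: boundedM.
Qed.

(** A monomial of [f] other than [m] is strictly smaller than [m], and its image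
    involves only monomials that are no larger than it; so nothing can
    interfere with the leading term. *)
Lemma lead_coef_subst h f m :
    (forall i, bounded (h i) U_(i)%MM) -> lead_mon le f m ->
    'X_[m].[: h] = 'X_[m] ->
  f.[: h]@_m = f@_m.
Proof.
move=> hU [mf m_max] hm.
rewrite comp_mpolyEX raddf_sum /= (bigD1_seq m) ?msupp_uniq //=.
rewrite hm linearZ /= mcoeffX eqxx mulr1 big_seq_cond big1 ?addr0 // => p.
case/andP=> pf p_neq_m; rewrite linearZ /= [X in _ * X]memN_msupp_eq0 ?mulr0 //.
apply: contraNN p_neq_m => /(bounded_subst hU) le_m_p.
by apply/eqP; case: le_term => _ le_anti *; apply: le_anti; rewrite m_max.
Qed.

(** A leading monomial of [J] in which no variable of [D] occurs would be fixed
    by [h], and so survive in the image of a polynomial that [h] kills. *)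
Lemma initial_ideal_sub_var_ideal J D h :
    {subset J <= [pred f | f.[: h] == 0]} ->
    (forall i, bounded (h i) U_(i)%MM) ->
    (forall i, i \notin D -> h i = 'X_i) ->
  {subset initial_ideal le J <= var_ideal D}.
Proof.
move=> hJ hU hD; apply: ideal_gen_sub; first exact: var_ideal_is_ideal.
move=> _ [f [m [/hJ/eqP f0 f_m ->]]]; rewrite var_ideal_monom.
apply: contraT => /exists_inPn mD.
have hm : 'X_[m].[: h] = 'X_[m].
  apply: subst_monom_id => i mi_gt0; apply: hD; apply: contraL mi_gt0.
  exact: mD.
case: f_m (lead_coef_subst hU f_m hm) => mf _; rewrite f0 mcoeff0.
by move=> /esym/eqP; rewrite mcoeff_eq0 mf.
Qed.

Lemma initial_ideal_monom J m : 'X_[m] \in J -> 'X_[m] \in initial_ideal le J.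
Proof.
move=> mJ; apply: mem_ideal_gen; exists 'X_[m], m; split=> //.
by split=> [|m']; rewrite msuppX inE // => /eqP->; apply: term_order_refl.
Qed.

End InitialIdeal.
End Substitution.

Arguments kill_vars k {n} D i.
Arguments var_ideal k {n} D _.

(** * Edge ideals and vertex covers *)

Section EdgeIdeal.
Variables (k : fieldType) (n : nat) (e : rel 'I_n).
Hypotheses (e_sym : ssrbool.symmetric e) (e_irr : irreflexive e).
Implicit Types (D C : {set 'I_n}) (P : {pred {mpoly k[n]}}).

Definition vertex_cover D : bool :=
  [forall i, forall j, e i j ==> (i \in D) || (j \in D)].

Lemma vertex_coverP D :
  reflect (forall i j, e i j -> (i \in D) || (j \in D)) (vertex_cover D).
Proof.
apply: (iffP forallP) => [De i j eij|De i].
  by have /forallP/(_ j)/implyP := De i; apply.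
by apply/forallP=> j; apply/implyP/De.
Qed.

Lemma vertex_coverU1 C i : vertex_cover C -> vertex_cover (i |: C).
Proof.
move/vertex_coverP=> Ce; apply/vertex_coverP=> u v /Ce.
by case/orP=> /setU1r->; rewrite ?orbT.
Qed.

Lemma edge_mem i j : e i j -> 'X_i * 'X_j \in edge_ideal k e.
Proof. by move=> eij; apply: mem_ideal_gen; exists i, j. Qed.

Lemma cover_of_prime P :
  prime_ideal P -> {subset edge_ideal k e <= P} ->
  vertex_cover [set i | 'X_i \in P].
Proof.
move=> Pp IP; apply/vertex_coverP => i j /edge_mem/IP; rewrite !inE.
by case: Pp => _; apply.
Qed.

Lemma edge_ideal_sub_ker (h : 'I_n -> {mpoly k[n]}) D :
    vertex_cover D -> {in D, forall i, h i = 0} ->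
  {subset edge_ideal k e <= [pred f | (f \mPo [tuple h i | i < n]) == 0]}.
Proof.
move=> /vertex_coverP De h0; apply: ideal_gen_sub.
  exact: ker_subst_is_ideal.
move=> _ [i [j [eij ->]]]; rewrite inE rmorphM /= !subst_var mulf_eq0.
by case/orP: (De _ _ eij) => /h0->; rewrite eqxx ?orbT.
Qed.

Lemma edge_ideal_sub_cover D :
  vertex_cover D -> {subset edge_ideal k e <= var_ideal k D}.
Proof.
by move=> De; apply: (edge_ideal_sub_ker De) => i; rewrite /kill_vars => ->.
Qed.

(** Since [C] without [v] is no longer a cover, it misses an edge, and this edge
    can only be covered by [v]. *)
Lemma minset_cover_private C v :
  minset vertex_cover C -> v \in C -> exists2 u, e v u & u \notin C.
Proof.
case/minsetP=> /vertex_coverP Ce Cmin vC.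
have : ~~ vertex_cover (C :\ v).
  by apply/negP=> /Cmin/(_ (subD1set _ _)) /setP/(_ v); rewrite !inE eqxx vC.
case/forallPn=> i /forallPn[j]; rewrite negb_imply !inE negb_or !negb_and !negbK.
case/and3P=> eij /orP[/eqP i_v|iC] /orP[/eqP j_v|jC].
- by rewrite i_v j_v e_irr in eij.
- by exists j; rewrite -?i_v.
- by exists i; rewrite -?j_v // e_sym.
by have := Ce _ _ eij; rewrite (negbTE iC) (negbTE jC).
Qed.

(** The variables in [P] form a vertex cover.  A minimal cover [C] inside it
    generates an associated prime contained in [P], which must then be [P]. *)
Lemma min_prime_edge_ideal P :
  min_assoc_prime (edge_ideal k e) P ->
  exists2 C, minset vertex_cover C & P = var_ideal k C.
Proof.
move=> [Pass Pmin]; have II : is_ideal (edge_ideal k e).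
  exact: ideal_gen_is_ideal.
have Pcover := cover_of_prime Pass.1 (assoc_prime_sub II Pass).
have [C Cmin C_P] := minset_exists Pcover; exists C => //.
have C_sub_P : {subset var_ideal k C <= P}.
  apply: var_ideal_min => [|i /(subsetP C_P)]; last by rewrite inE.
  exact: prime_ideal_is_ideal Pass.1.
have [Cass _] : min_assoc_prime (edge_ideal k e) (var_ideal k C).
  apply: min_assoc_var_ideal => // [|v vC].
    exact/edge_ideal_sub_cover/minsetp/Cmin.
  have [u evu uC] := minset_cover_private Cmin vC.
  by right; exists u => //; apply: edge_mem.
have P_sub_C := Pmin _ Cass C_sub_P.
by apply: funext => f; apply/idP/idP; [apply: P_sub_C | apply: C_sub_P].
Qed.

(** * Leaf pairs *)

(** If the support of [m] were independent, its complement would be a vertex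
    cover, whose prime contains the edge ideal but not ['X_[m]]. *)
Lemma monom_edge_ideal (m : 'X_{1..n}) :
  'X_[m] \in edge_ideal k e ->
  exists i j, [/\ e i j, (0 < m i)%N & (0 < m j)%N].
Proof.
move=> mI; pose D := [set i | m i == 0%N].
have : ~~ vertex_cover D.
  apply/negP=> /edge_ideal_sub_cover/(_ _ mI).
  by rewrite var_ideal_monom => /exists_inP[i]; rewrite inE => /eqP->.
case/forallPn=> i /forallPn[j]; rewrite negb_imply negb_or !inE -!lt0n.
by case/and3P=> eij mi mj; exists i, j.
Qed.

Lemma edge_monom_le i j (m : 'X_{1..n}) :
  e i j -> (0 < m i)%N -> (0 < m j)%N -> (U_(i) + U_(j) <= m)%MM.
Proof.
move=> eij mi mj; apply/mnm_lepP => l; rewrite mnmDE !mnm1E.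
case: eqP => [<-|_]; last by case: eqP => [<-|].
by case: eqP => // ji; rewrite ji e_irr in eij.
Qed.

Lemma le_edge_monom i j u (m : 'X_{1..n}) :
  (m <= U_(i) + U_(j))%MM -> (0 < m u)%N -> u = i \/ u = j.
Proof.
move=> /mnm_lepP/(_ u) m_le /leq_trans/(_ m_le).
by rewrite mnmDE !mnm1E addn_gt0 !lt0b => /orP[]/eqP->; [left | right].
Qed.

Lemma edge_monom_min_gen i j :
  e i j -> min_gen (edge_ideal k e) (U_(i) + U_(j))%MM.
Proof.
move=> eij; split=> [|m /monom_edge_ideal[u [v [euv mu mv]]] m_le].
  by rewrite mpolyXD edge_mem.
have ij_le : (U_(i) + U_(j) <= m)%MM.
  have [[u_i|u_j] [v_i|v_j]] := (le_edge_monom m_le mu, le_edge_monom m_le mv).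
  - by rewrite u_i v_i e_irr in euv.
  - by subst i j; apply: edge_monom_le.
  - by subst j i; apply: edge_monom_le.
  by rewrite u_j v_j e_irr in euv.
apply/mnmP => l; apply/eqP; rewrite eqn_leq.
by rewrite (mnm_lepP m_le) (mnm_lepP ij_le).
Qed.

Lemma min_gen_edge_ideal M :
  min_gen (edge_ideal k e) M -> exists i j, e i j /\ M = (U_(i) + U_(j))%MM.
Proof.
case=> /monom_edge_ideal[i [j [eij Mi Mj]]] Mmin; exists i, j; split=> //.
by rewrite -(Mmin _ _ (edge_monom_le eij Mi Mj)) // mpolyXD edge_mem.
Qed.

Lemma leaf_neighbour a M :
    leaf (edge_ideal k e) a -> min_gen (edge_ideal k e) M -> (U_(a) <= M)%MM ->
  exists x, [/\ M = (U_(a) + U_(x))%MM, e a x & forall u, e a u -> u = x].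
Proof.
move=> [M' [_ M'uniq]] Mgen aM.
have [x [eax M_ax]] : exists x, e a x /\ M = (U_(a) + U_(x))%MM.
  have [i [j [eij M_ij]]] := min_gen_edge_ideal Mgen.
  move: aM; rewrite M_ij => /mnm_lepP/(_ a).
  rewrite mnmDE !mnm1E eqxx addn_gt0 !lt0b => /orP[]/eqP def_a.
    by exists j; rewrite -def_a.
  by exists i; rewrite -def_a e_sym addmC.
exists x; split=> // u eau.
have /eqP := etrans (esym (M'uniq _ (conj Mgen aM)))
  (M'uniq _ (conj (edge_monom_min_gen eau) (lem_addr _ _))).
by rewrite M_ax eqm_add2l => /eqP/mnmP/(_ x); rewrite !mnm1E eqxx; case: eqP.
Qed.

(** The two generators are the edges [a x] and [y b] at the leaves.  In the
    definition of a leaf pair, [z] and [w] then divide [x] and [y], so that an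
    edge monomial dividing [z * w] can only be [x * y].  If [x] were [b], then
    [a] and [b] would be adjacent and the two generators would coincide. *)
Lemma leaf_pair_path a b :
    leaf_pair (edge_ideal k e) a b ->
  exists x y, [/\ e a x, e x y, forall u, e a u -> u = x,
                  forall u, e b u -> u = y & x != b].
Proof.
move=> [leaf_a [leaf_b [M1 [M2 [[M1gen aM1] [M2gen bM2] M12 [z [w]]]]]]].
have [x [M1_ax eax ax]] := leaf_neighbour leaf_a M1gen aM1.
have [y [M2_by _ b_y]] := leaf_neighbour leaf_b M2gen bM2.
case=> _ [az zM1] [bw wM2] /monom_edge_ideal[i [j [eij]]].
have only_z u : (0 < z u)%N -> u = x.
  rewrite M1_ax in zM1 => zu; have [u_a|//] := le_edge_monom zM1 zu.
  by rewrite lep1mP -lt0n -u_a zu in az.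
have only_w u : (0 < w u)%N -> u = y.
  rewrite M2_by in wM2 => wu; have [u_b|//] := le_edge_monom wM2 wu.
  by rewrite lep1mP -lt0n -u_b wu in bw.
rewrite !mnmDE !addn_gt0 => zwi zwj.
have exy : e x y.
  case/orP: zwi zwj => [/only_z|/only_w] i_; case/orP=> [/only_z|/only_w] j_.
  - by rewrite i_ j_ e_irr in eij.
  - by rewrite -i_ -j_.
  - by rewrite -i_ -j_ e_sym.
  by rewrite i_ j_ e_irr in eij.
exists x, y; split=> //; apply/eqP => x_b; apply: M12.
have a_y : a = y by apply: b_y; rewrite -x_b e_sym.
by rewrite M1_ax M2_by x_b a_y addmC.
Qed.

(** * The initial ideal of the specialization at [a + b] *)

Section Specialization.
Variables (le : rel 'X_{1..n}) (a b : 'I_n).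
Hypotheses (le_term : term_order le) (gt_ab : term_gt le U_(a)%MM U_(b)%MM).

Let J := ideal_adj (edge_ideal k e) ('X_a + 'X_b).
Let I1 := initial_ideal le J.

Lemma term_gt_var_neq : a != b.
Proof. by case/andP: gt_ab => ab _; apply: contraNneq ab => ->. Qed.

Lemma initial_larger_var : 'X_a \in I1.
Proof.
apply: mem_ideal_gen; exists ('X_a + 'X_b), U_(a)%MM.
split=> //; first exact: mem_ideal_adjr.
split=> [|m /msuppD_le].
  rewrite mcoeff_msupp mcoeffD !mcoeffXU eqxx [b == a]eq_sym.
  by rewrite (negbTE term_gt_var_neq) addr0 oner_eq0.
rewrite mem_cat !msuppX !inE => /orP[]/eqP->; first exact: term_order_refl.
by case/andP: gt_ab.
Qed.

Lemma initial_edge i j : e i j -> 'X_i * 'X_j \in I1.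
Proof.
move=> /edge_mem ijI; rewrite -mpolyXD; apply: initial_ideal_monom => //.
by rewrite mpolyXD; apply: mem_ideal_adjl.
Qed.

Lemma initial_moved_edge x : e a x -> 'X_x * 'X_b \in I1.
Proof.
move=> eax; have JI : is_ideal J := ideal_adj_is_ideal _ _.
rewrite -mpolyXD; apply: initial_ideal_monom => //; rewrite mpolyXD.
have -> : 'X_x * 'X_b = 'X_x * ('X_a + 'X_b) + -1 * ('X_a * 'X_x)
    :> {mpoly k[n]}.
  by rewrite mulrDr mulN1r [_ * 'X_x]mulrC addrAC subrr add0r.
apply: is_idealD => //; first exact/is_idealM/mem_ideal_adjr.
by apply: is_idealM => //; apply/mem_ideal_adjl/edge_mem.
Qed.

(** Modulo [a + b] the variable [a] becomes [- b], which is smaller in the term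
    order; this rewriting and killing [C] moves only variables of [a |: C]. *)
Lemma initial_sub_coverU1 C :
  vertex_cover C -> a \notin C -> {subset I1 <= var_ideal k (a |: C)}.
Proof.
move=> Ce aC.
(* [kill_vars k C b] instead of ['X_b], so that [a + b] is killed also when [b]
   is in [C]. *)
pose h i := if i == a then - kill_vars k C b else kill_vars k C i.
apply: (initial_ideal_sub_var_ideal (h := h) le_term) => [|i|i].
- apply: ideal_adj_sub; first exact: ker_subst_is_ideal.
    apply: (edge_ideal_sub_ker Ce) => i iC; rewrite /h /kill_vars iC.
    by case: eqP => // i_a; rewrite -i_a iC in aC.
  rewrite inE rmorphD /= !subst_var /h eqxx [b == a]eq_sym.
  by rewrite (negbTE term_gt_var_neq) addNr.
- rewrite /h /kill_vars; case: eqP => [->|_]; last first.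
    by case: ifP => _; [apply: bounded0 | apply: bounded_var].
  case: ifP => _; first by rewrite oppr0; apply: bounded0.
  move=> m; rewrite (perm_mem (msuppN _)) msuppX inE => /eqP->.
  by case/andP: gt_ab.
by rewrite !inE negb_or /h /kill_vars => /andP[/negbTE-> /negbTE->].
Qed.

Lemma initial_sub_cover D :
    vertex_cover D -> a \in D -> b \in D -> {subset I1 <= var_ideal k D}.
Proof.
move=> De aD bD.
apply: (initial_ideal_sub_var_ideal (h := kill_vars k D) le_term) => [|i|i].
- apply: ideal_adj_sub; first exact: ker_subst_is_ideal.
    exact: edge_ideal_sub_cover.
  by apply: is_idealD; rewrite ?var_ideal_var //; apply: var_ideal_is_ideal.
- by rewrite /kill_vars; case: ifP => _; [apply: bounded0 | apply: bounded_var].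
by rewrite /kill_vars => /negbTE->.
Qed.

End Specialization.
End EdgeIdeal.

(** * Minimal primes of the initial ideal *)

Theorem lemma2p4 (k : fieldType) (n : nat) (e : rel 'I_n)
    (e_sym : ssrbool.symmetric e) (e_irr : irreflexive e)
    (P : {pred {mpoly k[n]}})
    (minP : min_assoc_prime (edge_ideal k e) P)
    (a b : 'I_n) (ab_leaf : leaf_pair (edge_ideal k e) a b)
    (le : rel 'X_{1..n}) (le_term : term_order le)
    (gt_ab : term_gt le U_(a)%MM U_(b)%MM) :
  let I1 := initial_ideal le (ideal_adj (edge_ideal k e) ('X_a + 'X_b)) in
  ('X_a \notin P -> min_assoc_prime I1 (ideal_adj P 'X_a)) /\
  ('X_a \in P -> min_assoc_prime I1 (ideal_adj P 'X_b)).
Proof.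
rewrite /=; set I1 := initial_ideal le _.
have [x [y [eax exy ax b_y x_neq_b]]] := leaf_pair_path e_sym e_irr ab_leaf.
have [C Cmin ->] := min_prime_edge_ideal e_sym e_irr minP.
have private v := minset_cover_private e_sym e_irr Cmin (v := v).
have Ce : vertex_cover e C := minsetp Cmin.
have I1I : is_ideal I1 := ideal_gen_is_ideal _.
have a_I1 : 'X_a \in I1 := initial_larger_var k e le_term gt_ab.
have edge_I1 i j : e i j -> 'X_i * 'X_j \in I1 by apply: initial_edge.
have xb_I1 : 'X_x * 'X_b \in I1 by apply: initial_moved_edge.
rewrite var_ideal_var !var_ideal_adj; split=> aC.
  apply: min_assoc_var_ideal => // [|v /setU1P[->|vC]].
  - exact: initial_sub_coverU1.
  - by left.
  right.
  have notD u : u != a -> u \notin C -> u \notin a |: C.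
    by move=> ua uC; rewrite !inE negb_or ua.
  have [u evu uC] := private v vC.
  have [u_a|ua] := eqVneq u a; last by exists u; [apply: notD | apply: edge_I1].
  have -> : v = x by apply: ax; rewrite -u_a e_sym.
  have [bC|bC] := boolP (b \in C); last first.
    exists b => //; apply: notD; rewrite // eq_sym.
    exact: term_gt_var_neq gt_ab.
  exists y; last exact: edge_I1.
  apply: notD; last by have [y' /b_y->] := private b bC.
  (* If [y] were [a], then [a] would be adjacent to [b], so [b] would be [x]. *)
  apply: contraNneq x_neq_b => y_a; apply/eqP/esym/ax.
  by have [y' eby'] := private b bC; rewrite -y_a -(b_y _ eby') e_sym.
have xD : x \notin b |: C.
  by have [x' /ax->] := private a aC; rewrite !inE negb_or x_neq_b.
apply: min_assoc_var_ideal => // [|v /setU1P[->|vC]].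
- by apply: initial_sub_cover; rewrite ?setU11 ?setU1r ?vertex_coverU1.
- by right; exists x => //; rewrite mulrC.
right; have [u evu uC] := private v vC.
have [u_b|ub] := eqVneq u b; last first.
  by exists u; [rewrite !inE negb_or ub | apply: edge_I1].
have -> : v = y by apply: b_y; rewrite -u_b e_sym.
by exists x => //; apply: edge_I1; rewrite e_sym.
Qed.
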